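(* Let $\mathcal{O}$ be a split complete discrete valuation ring with field of fractions $A$. For any $n\geq 1$: (a) an $\mathcal{O}$-submodule $M$ of $A^n$ is fractional if and only if it has no nonzero divisible elements; (b) $|\mathcal{M}_n(\mathcal{O})/GL_n(A)|=n+1$, and the $GL_n(A)$-orbit of $M\in\mathcal{M}_n(\mathcal{O})$ is completely determined by $\dim_A(AM)$.
   Context: A complete discrete valuation ring $\mathcal{O}$ is called split if its residue field is a subring of $\mathcal{O}$ (e.g. $\mathcal{O}=\mathbf{k}[[t]]$ for a field $\mathbf{k}$). An $\mathcal{O}$-submodule $M$ of $A^n$ is called fractional if there is $\gamma\in GL_n(A)$ with $\gamma(M)\subseteq\mathcal{O}^n$. $\mathcal{M}_n(\mathcal{O})$ is the set of all fractional $\mathcal{O}$-submodules of $A^n$ (including $0$), on which $GL_n(A)$ acts by $g\cdot M=g(M)$. An element $x$ of an $\mathcal{O}$-module $M$ is divisible if for every $0\neq a\in\mathcal{O}$ there is $y\in M$ with $x=ay$. $AM$ denotes the $A$-span of $M$. *)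

(* Defs.v *)
From HB Require Import structures.
From mathcomp Require Import all_boot all_order all_algebra.
From mathcomp Require Import all_classical.

Set Implicit Arguments.
Unset Strict Implicit.
Unset Printing Implicit Defensive.

Import Order.TTheory GRing.Theory Num.Theory.
Local Open Scope classical_set_scope.
Local Open Scope ring_scope.

Section DiscreteValuationRings.
Variable O : idomainType.

(* A discrete valuation K^* -> Z is represented by a function defined on all
   of K, whose value at 0 is irrelevant; [0] has valuation +oo by convention,
   which is what [val_ge] encodes. *)
Definition discrete_valuation (K : fieldType) (v : K -> int) : Prop :=
  [/\ forall x y, x != 0 -> y != 0 -> v (x * y) = v x + v y,
      forall x y, x != 0 -> y != 0 -> x + y != 0 ->
        Num.min (v x) (v y) <= v (x + y)
    & forall m : int, exists2 x, x != 0 & v x = m].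

Definition val_ge (K : fieldType) (v : K -> int) (m : int) (x : K) : Prop :=
  x = 0 \/ m <= v x.

Definition is_valuation_ring (v : {fraction O} -> int) : Prop :=
  forall x : {fraction O}, (exists a : O, x = tofrac a) <-> val_ge v 0 x.

(* Completeness for the topology defined by the powers of the maximal ideal,
   the k-th power being {a | v(a) >= k}. *)
Definition val_cauchy (v : {fraction O} -> int) (u : nat -> O) : Prop :=
  forall k : nat, exists N : nat, forall i j : nat, (N <= i)%N -> (N <= j)%N ->
    val_ge v k%:Z (tofrac (u i - u j)).

Definition val_converges (v : {fraction O} -> int) (u : nat -> O) (l : O) :
    Prop :=
  forall k : nat, exists N : nat, forall i : nat, (N <= i)%N ->
    val_ge v k%:Z (tofrac (u i - l)).

Definition val_complete (v : {fraction O} -> int) : Prop :=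
  forall u : nat -> O, val_cauchy v u -> exists l : O, val_converges v u l.

Definition complete_dvr : Prop :=
  exists v : {fraction O} -> int,
    [/\ discrete_valuation v, is_valuation_ring v & val_complete v].

(* In a local ring the maximal ideal is the set of non-units: [res] is the
   quotient map of [O] onto its residue field. *)
Definition is_residue_map (k : fieldType) (res : {rmorphism O -> k}) : Prop :=
  (forall y : k, exists x : O, res x = y) /\
  (forall x : O, res x = 0 <-> x \isn't a GRing.unit).

(* The residue field is a subring of [O] through a ring section of the
   quotient map, as k sits in k[[t]] as the constants. *)
Definition split_residue_field : Prop :=
  exists (k : fieldType) (res : {rmorphism O -> k}),
    is_residue_map res /\ exists s : {rmorphism k -> O}, cancel s res.

End DiscreteValuationRings.

Section FractionalModules.
Variables (O : idomainType) (n : nat).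
Local Notation A := {fraction O}.
Implicit Types (M N : set 'cV[A]_n) (g : 'M[A]_n).

Definition O_submodule M : Prop :=
  [/\ M 0, forall x y, M x -> M y -> M (x + y)
    & forall (a : O) x, M x -> M (tofrac a *: x)].

(* O^n inside A^n *)
Definition O_lattice : set 'cV[A]_n :=
  [set x | forall i, exists a : O, x i 0 = tofrac a].

Definition GL_act g M : set 'cV[A]_n := [set g *m x | x in M].

Definition fractional M : Prop :=
  exists2 g, g \in unitmx & GL_act g M `<=` O_lattice.

Definition divisible M (x : 'cV[A]_n) : Prop :=
  forall a : O, a != 0 -> exists2 y, M y & x = tofrac a *: y.

Definition fractional_submodules : set (set 'cV[A]_n) :=
  [set M | O_submodule M /\ fractional M].

Definition GL_orbit M : set (set 'cV[A]_n) :=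
  [set GL_act g M | g in [set g | g \in unitmx]].

Definition GL_orbits : set (set (set 'cV[A]_n)) :=
  [set GL_orbit M | M in fractional_submodules].

Definition is_A_span M (V : {vspace 'cV[A]_n}) : Prop :=
  forall x, x \in V <->
    exists2 X : seq 'cV[A]_n, (forall y, y \in X -> M y) & x \in <<X>>%VS.

Definition A_span M : {vspace 'cV[A]_n} := xget 0%VS [set V | is_A_span M V].

Lemma A_spanP M : is_A_span M (A_span M).
Proof.
apply: (@xgetPex _ _ [set V | is_A_span M V]).
pose P d := `[< exists2 X : seq 'cV[A]_n,
  (forall y, y \in X -> M y) & \dim <<X>>%VS = d >].
have P0 : exists d, P d.
  by exists 0%N; apply/asboolP; exists [::] => //; rewrite span_nil dimv0.
have Pmax d : P d -> (d <= \dim {:'cV[A]_n})%N.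
  by move=> /asboolP[X _ <-]; apply/dimvS/subvf.
case: (ex_maxnP P0 Pmax) => d /asboolP[X XM Xd] dmax.
exists <<X>>%VS => x; split=> [xX|[Y YM xY]]; first by exists X.
have : <<X>>%VS == <<X ++ Y>>%VS.
  rewrite eqEdim span_cat addvSl -span_cat Xd dmax//; apply/asboolP.
  exists (X ++ Y) => // y; rewrite mem_cat => /orP[/XM//|/YM//].
by move=> /eqP->; rewrite span_cat; apply: subvP xY; rewrite addvSr.
Qed.

End FractionalModules.

Arguments GL_orbits : clear implicits.

(* Main.v *)
Require Import Defs.
From HB Require Import structures.
From mathcomp Require Import all_boot all_order all_algebra.
From mathcomp Require Import all_classical.
From mathcomp Require Import zify.

Set Implicit Arguments.
Unset Strict Implicit.
Unset Printing Implicit Defensive.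

Import Order.TTheory GRing.Theory Num.Theory.
Local Open Scope classical_set_scope.
Local Open Scope ring_scope.

(** Let A = Frac O. Call a submodule of A^n of the form B * O^r, with B an
    n x r matrix of rank r, a column lattice. The heart of the matter is that a
    submodule M of A^n without nonzero divisible elements is a column lattice
    ([column_lattice_of_no_divisible]). This goes by induction on n, along the
    projection A^(1+n) -> A^n which forgets the first coordinate.
    - The kernel of the projection meets M in a submodule of A, and a
      submodule of A is either A, which is divisible, or gO for some g
      ([submodule_full_or_principal]).
    - The image of M again has no nonzero divisible element
      ([projection_divisible0]). This is where completeness enters: if x is
      divisible in the image, then the points (c_k, x) of p^k M above x, for p
      a uniformizer, differ by elements of the kernel gO which are p-adically
      small, so that they converge to a point of M above x, divisible in M.
    - By induction the image is a column lattice, with basis B. Lifts to M of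
      the columns of B, together with the vector (g, 0) if g is nonzero, form
      a basis of M ([column_lattice_extend]).

    Everything else is linear algebra. GL_n(A) acts transitively on the n x r
    matrices of rank r ([full_colrank_transitive]), hence on the column
    lattices of rank r, and r is the dimension of the A-span
    ([dim_A_span_column_lattice]). In particular a column lattice of rank r is
    in the orbit of O^r x 0, so it is fractional; conversely a fractional
    module has no nonzero divisible element because the powers of p have
    intersection 0 in O ([fractional_divisible0]). So the fractional modules
    are the column lattices, and their orbits are classified by r, which
    runs from 0 to n. *)

(** * Arithmetic of a complete discrete valuation ring *)

Section Valuation.
Variables (O : idomainType) (v : {fraction O} -> int).
Hypotheses (v_val : discrete_valuation v) (v_ring : is_valuation_ring v).
Local Notation A := {fraction O}.

Lemma val_mul (x y : A) : x != 0 -> y != 0 -> v (x * y) = v x + v y.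
Proof. by case: v_val => vM _ _; apply: vM. Qed.

Lemma val1 : v 1 = 0.
Proof.
by apply: (@addrI _ (v 1)); rewrite -val_mul ?oner_neq0// mulr1 addr0.
Qed.

Lemma val_inv (x : A) : x != 0 -> v x^-1 = - v x.
Proof.
move=> x0; have xV0 : x^-1 != 0 by rewrite invr_eq0.
by have := val_mul x0 xV0; rewrite mulfV// val1; lia.
Qed.

Lemma val_exp (x : A) k : x != 0 -> v (x ^+ k) = v x * k%:Z.
Proof.
move=> x0; elim: k => [|k IHk]; first by rewrite expr0 val1 mulr0.
by rewrite exprS val_mul ?expf_neq0// IHk; lia.
Qed.

Lemma val_ge_multiple (x y : A) :
  x != 0 -> val_ge v (v x) y -> exists a : O, y = tofrac a * x.
Proof.
move=> x0 vy; have [->|y0] := eqVneq y 0.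
  by exists 0; rewrite tofrac0 mul0r.
have [a ya] : exists a : O, y / x = tofrac a.
  apply/v_ring; right; rewrite val_mul ?invr_eq0// val_inv//.
  by case: vy => [y00|]; [rewrite y00 eqxx in y0|lia].
by exists a; rewrite -ya divfK.
Qed.

(** Either the valuations of the elements of I are unbounded below, and every
    element of A is an O-multiple of one of them, or a nonzero element of
    minimal valuation generates I; the zero module is the case g = 0. *)
Lemma submodule_full_or_principal (I : set A) :
    I 0 -> (forall (a : O) x, I x -> I (tofrac a * x)) ->
  (forall x, I x) \/
  exists g, forall x, I x <-> exists a : O, x = tofrac a * g.
Proof.
move=> I0 IM.
have Isub x y : I x -> x != 0 -> v x <= v y -> I y.
  move=> Ix x0 xy.
  by have [|a ->] := @val_ge_multiple x y x0; [right|apply: IM].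
have [[m Im]|unb] := pselect (exists m : int,
    forall x, I x -> x != 0 -> m <= v x); last first.
  left=> y; apply/not_notP => yI; apply: unb; exists (v y) => x Ix x0.
  have [//|yx] := leP (v y) (v x).
  by case: yI; apply: Isub Ix x0 (ltW yx).
right; have [I00|] := pselect (forall x, I x -> x = 0).
  exists 0 => x; split=> [/I00->|[a ->]]; last by rewrite mulr0.
  by exists 0; rewrite mulr0.
move=> /existsNP[x /not_implyP[Ix /eqP x0]].
pose P d := `[< exists x, [/\ I x, x != 0 & v x = m + d%:Z] >].
have exP : exists d, P d.
  exists (absz (v x - m)); apply/asboolP; exists x; split=> //.
  by have := Im x Ix x0; lia.
case: (ex_minnP exP) => d /asboolP[g [Ig g0 vg]] dmin.
exists g => y; split=> [Iy|[a ->]]; last exact: IM.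
have [->|y0] := eqVneq y 0; first by exists 0; rewrite tofrac0 mul0r.
apply: val_ge_multiple => //; right; have my := Im y Iy y0.
suff : (d <= absz (v y - m))%N by lia.
by apply: dmin; apply/asboolP; exists y; split=> //; lia.
Qed.

Lemma uniformizer : exists2 p : O, p != 0 & v (tofrac p) = 1.
Proof.
case: v_val => _ _ /(_ 1)[x x0 vx].
have [p xp] : exists p : O, x = tofrac p by apply/v_ring; right; rewrite vx.
by exists p; rewrite -?xp// -tofrac_eq0 -xp.
Qed.

Variable p : O.
Hypotheses (p0 : p != 0) (vp : v (tofrac p) = 1).

Lemma val_uniformizerX k : v (tofrac (p ^+ k)) = k%:Z.
Proof. by rewrite tofracXn val_exp ?tofrac_eq0// vp mul1r. Qed.

Lemma uniformizerX_neq0 k : tofrac (p ^+ k) != 0.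
Proof. by rewrite tofrac_eq0 expf_neq0. Qed.

Lemma val_ge_uniformizerX (k : nat) (a : O) :
  val_ge v k%:Z (tofrac a) <-> exists b, a = p ^+ k * b.
Proof.
split=> [|[b ->]].
  rewrite -val_uniformizerX => /(val_ge_multiple (uniformizerX_neq0 k))[b].
  rewrite -tofracM => /eqP; rewrite tofrac_eq => /eqP->.
  by exists b; rewrite mulrC.
have [->|b0] := eqVneq b 0; first by left; rewrite mulr0 tofrac0.
right; rewrite tofracM val_mul ?uniformizerX_neq0 ?tofrac_eq0//.
rewrite val_uniformizerX.
have [/eqP|] : val_ge v 0 (tofrac b) by apply/v_ring; exists b.
  by rewrite tofrac_eq0 (negPf b0).
by lia.
Qed.

(** Reduces divisibility by all nonzero elements of O to divisibility by the
    powers of the uniformizer. *)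
Lemma multiple_uniformizerX (a : O) : a != 0 -> exists k b, p ^+ k = a * b.
Proof.
move=> a0; have ta0 : tofrac a != 0 by rewrite tofrac_eq0.
have va : 0 <= v (tofrac a).
  have [/eqP|//] : val_ge v 0 (tofrac a) by apply/v_ring; exists a.
  by rewrite (negPf ta0).
exists (absz (v (tofrac a))).
have [|b] := @val_ge_multiple _ (tofrac (p ^+ absz (v (tofrac a)))) ta0.
  by right; rewrite val_uniformizerX; lia.
rewrite -tofracM => /eqP; rewrite tofrac_eq => /eqP->.
by exists b; rewrite mulrC.
Qed.

Lemma uniformizer_separated (a : O) :
  (forall k, exists b, a = p ^+ k * b) -> a = 0.
Proof.
move=> ap; apply/eqP/negPn/negP => a0.
have /val_ge_uniformizerX[/eqP|] := ap (absz (v (tofrac a))).+1.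
  by rewrite tofrac_eq0 (negPf a0).
by lia.
Qed.

Hypothesis v_complete : val_complete v.

(** Completeness in the form used below: increments divisible by p^k make the
    sequence Cauchy, with the same rate of convergence to its limit. *)
Lemma adic_limit (c : nat -> O) :
    (forall k, exists a, c k.+1 - c k = p ^+ k * a) ->
  exists l, forall k, exists a, l - c k = p ^+ k * a.
Proof.
move=> cS.
have cD k j : exists a, c (k + j)%N - c k = p ^+ k * a.
  elim: j => [|j [a ca]]; first by exists 0; rewrite addn0 subrr mulr0.
  have [b cb] := cS (k + j)%N; exists (p ^+ j * b + a).
  by rewrite mulrDr -ca mulrA -exprD -cb addnS addrA subrK.
have [|l cl] := v_complete (u := c).
  move=> k; exists k => i j ki kj; apply/val_ge_uniformizerX.
  have [a ca] := cD k (i - k)%N; have [b cb] := cD k (j - k)%N.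
  rewrite !subnKC// in ca cb; exists (a - b).
  by rewrite mulrBr -ca -cb opprB addrA subrK.
exists l => k; have [N /(_ (k + N)%N (leq_addl _ _))] := cl k.
move=> /val_ge_uniformizerX[a ca]; have [b cb] := cD k N.
by exists (b - a); rewrite mulrBr -ca -cb opprB [RHS]addrC addrA subrK.
Qed.

End Valuation.

(** * Matrices of full column rank *)

Section ColumnRank.
Variable F : fieldType.

Lemma row_full_col_mx m n r (b : 'M[F]_(m, r)) (B : 'M[F]_(n, r)) :
  row_full B -> row_full (col_mx b B).
Proof.
move=> /row_fullP[L LB]; apply/row_fullP.
by exists (row_mx 0 L); rewrite mul_row_col mul0mx add0r.
Qed.

Lemma row_full_block_triangular m n r (g : F) (b : 'M[F]_(m, r))
    (B : 'M[F]_(n, r)) :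
  g != 0 -> row_full B -> row_full (block_mx g%:M b 0 B).
Proof.
move=> g0 /row_fullP[L LB]; apply/row_fullP.
exists (block_mx g^-1%:M (- (g^-1%:M *m b *m L)) 0 L).
rewrite mulmx_block !mulmx0 !mul0mx !addr0 !add0r LB.
rewrite mulNmx -(mulmxA _ L) LB mulmx1.
by rewrite subrr -scalar_mxM mulVf// -scalar_mx_block.
Qed.

(** A linear map carrying the columns of B to those of C exists because B has a
    left inverse; [complete_unitmx] makes it invertible. That result concerns
    row vectors, hence the transposes. *)
Lemma full_colrank_transitive n r (B C : 'M[F]_(n, r)) :
  row_full B -> row_full C -> exists2 g : 'M[F]_n, g \in unitmx & g *m B = C.
Proof.
move=> Bf Cf; have BTf : row_free B^T by rewrite /row_free mxrank_tr.
have BC : B^T *m (pinvmx B^T *m C^T) = C^T by rewrite mulmxA mulmxVp// mul1mx.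
have [|g gu gBC] := @complete_unitmx _ _ _ B^T (pinvmx B^T *m C^T).
  by rewrite BC !mxrank_tr (eqP Bf) (eqP Cf).
exists g^T; first by rewrite unitmx_tr.
by apply: trmx_inj; rewrite trmx_mul trmxK -gBC BC.
Qed.

Lemma mulmx_sum_cols n r (B : 'M[F]_(n, r)) (c : 'cV[F]_r) :
  B *m c = \sum_j c j 0 *: col j B.
Proof.
apply/matrixP => i k; rewrite !mxE summxE; apply: eq_bigr => j _.
by rewrite !mxE (ord1 k) mulrC.
Qed.

Lemma pid_mx_row_full n r : (r <= n)%N -> row_full (pid_mx r : 'M[F]_(n, r)).
Proof. by move=> rn; rewrite /row_full rank_pid_mx. Qed.

End ColumnRank.

(** * Column lattices and their orbits *)

Section Modules.
Variable O : idomainType.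
Local Notation A := {fraction O}.

Definition column_lattice n r (B : 'M[A]_(n, r)) : set 'cV[A]_n :=
  [set B *m c | c in @O_lattice O r].

Lemma column_lattice_act n r (B : 'M[A]_(n, r)) (g : 'M[A]_n) :
  GL_act g (column_lattice B) = column_lattice (g *m B).
Proof.
apply/seteqP; split=> x.
  by move=> [_ [c cO <-] <-]; exists c => //; rewrite mulmxA.
by move=> [c cO <-]; exists (B *m c); [exists c|rewrite mulmxA].
Qed.

Lemma column_lattice_sub n r (M : set 'cV[A]_n) (B : 'M[A]_(n, r)) :
  O_submodule M -> (forall j, M (col j B)) -> column_lattice B `<=` M.
Proof.
move=> [M0 MD MZ] MB _ [c cO <-].
rewrite mulmx_sum_cols.
elim/big_ind: _ => // j _.
by have [a ->] := cO j; apply: MZ.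
Qed.

Lemma O_lattice_submodule n : O_submodule (@O_lattice O n).
Proof.
split=> [|x y xO yO i|a x xO i].
  by move=> i; exists 0; rewrite mxE tofrac0.
  have [[b xb] [c yc]] := (xO i, yO i).
  by exists (b + c); rewrite mxE xb yc tofracD.
by have [b xb] := xO i; exists (a * b); rewrite mxE xb tofracM.
Qed.

Lemma dim_A_span_column_lattice n r (B : 'M[A]_(n, r)) :
  row_full B -> \dim (A_span (column_lattice B)) = r.
Proof.
move=> Bf; have /row_fullP[L LB] := Bf.
pose f : 'Hom('cV[A]_r, 'cV[A]_n) := linfun (mulmx B).
have -> : A_span (column_lattice B) = limg f.
  apply/vspaceP => x; apply/idP/idP.
    move=> /A_spanP[X XB]; apply: subvP; apply/span_subvP => y /XB[c _ <-].
    by apply/memv_imgP; exists c; rewrite ?memvf// lfunE.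
  move=> /memv_imgP[c _ ->]; rewrite lfunE /=; apply/A_spanP.
  exists [seq col j B | j : 'I_r].
    move=> _ /mapP[j _ ->]; exists (delta_mx j 0); last by rewrite colE.
    by move=> i; exists (i == j)%:R; rewrite mxE eqxx andbT rmorph_nat.
  rewrite mulmx_sum_cols.
  apply: memv_suml => j _; apply/memvZ/memv_span/map_f.
  by rewrite mem_enum.
rewrite limg_dim_eq ?dimvf ?dim_matrix; first exact: muln1.
apply/eqP; rewrite capfv; apply/lker0P => x y; rewrite !lfunE /= => xy.
by rewrite -[x]mul1mx -[y]mul1mx -LB -!mulmxA xy.
Qed.

Lemma GL_act1 n (M : set 'cV[A]_n) : GL_act 1%:M M = M.
Proof.
apply/seteqP; split=> x; first by move=> [y My <-]; rewrite mul1mx.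
by move=> Mx; exists x => //; rewrite mul1mx.
Qed.

Lemma GL_actM n (g h : 'M[A]_n) (M : set 'cV[A]_n) :
  GL_act g (GL_act h M) = GL_act (g *m h) M.
Proof.
apply/seteqP; split=> x.
  by move=> [_ [y My <-] <-]; exists y => //; rewrite mulmxA.
by move=> [y My <-]; exists (h *m y); [exists y|rewrite mulmxA].
Qed.

Lemma GL_orbit_act n (g : 'M[A]_n) (M : set 'cV[A]_n) :
  g \in unitmx -> GL_orbit (GL_act g M) = GL_orbit M.
Proof.
move=> gu; apply/seteqP; split=> _ [h hu <-].
  exists (h *m g); last by rewrite (GL_actM h g M).
  by rewrite /= unitmx_mul (hu : h \in unitmx) gu.
exists (h *m invmx g).
  by rewrite /= unitmx_mul unitmx_inv gu (hu : h \in unitmx).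
by rewrite (GL_actM _ g M) (mulmxKV gu).
Qed.

(** The rank is an invariant of the orbit, as the dimension of the span of any
    of its members, and it is the only one by transitivity. *)
Lemma GL_orbit_column_lattice n r s (B : 'M[A]_(n, r)) (C : 'M[A]_(n, s)) :
    row_full B -> row_full C ->
  GL_orbit (column_lattice B) = GL_orbit (column_lattice C) <-> r = s.
Proof.
move=> Bf Cf; split=> [BC|rs].
  have : GL_orbit (column_lattice C) (column_lattice B).
    by rewrite -BC; exists 1%:M; [exact: unitmx1|exact: GL_act1].
  case=> g gu; rewrite column_lattice_act => gCB.
  rewrite -(dim_A_span_column_lattice Bf) -gCB dim_A_span_column_lattice//.
  by rewrite /row_full eqmxMfull// row_full_unit.
subst s; have [g gu <-] := full_colrank_transitive Bf Cf.
by rewrite -column_lattice_act GL_orbit_act.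
Qed.

(** A matrix sending B to the truncated identity matrix sends B * O^r into
    O^n. *)
Lemma column_lattice_fractional n r (B : 'M[A]_(n, r)) :
  row_full B -> fractional_submodules (column_lattice B).
Proof.
move=> Bf; split.
  have [O0 OD OZ] := O_lattice_submodule r; split.
  - by exists 0; rewrite ?mulmx0.
  - move=> x y [c cO <-] [d dO <-].
    by exists (c + d); [exact: OD|rewrite mulmxDr].
  - by move=> a _ [c cO <-]; exists (tofrac a *: c);
      [exact: OZ|rewrite -scalemxAr].
have rn : (r <= n)%N by rewrite -(eqP Bf) rank_leq_row.
have [g gu gB] := full_colrank_transitive Bf (pid_mx_row_full _ rn).
exists g => //; rewrite column_lattice_act gB.
apply: column_lattice_sub; first exact: O_lattice_submodule.
move=> j i; exists ((i == j :> nat) && (i < r)%N)%:R.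
by rewrite !mxE rmorph_nat.
Qed.

End Modules.

(** * Modules without divisible elements are column lattices *)

Section Structure.
Variables (O : idomainType) (v : {fraction O} -> int) (p : O).
Hypotheses (v_val : discrete_valuation v) (v_ring : is_valuation_ring v).
Hypotheses (p0 : p != 0) (vp : v (tofrac p) = 1).
Local Notation A := {fraction O}.

Lemma divisible_uniformizer n (M : set 'cV[A]_n) x : O_submodule M ->
  (forall k, exists2 y, M y & x = tofrac (p ^+ k) *: y) -> divisible M x.
Proof.
move=> [_ _ MZ] xp a /(multiple_uniformizerX v_val v_ring p0 vp)[k [b pab]].
have [y My ->] := xp k; exists (tofrac b *: y); first exact: MZ.
by rewrite pab scalerA -tofracM.
Qed.

(** After a change of coordinates the entries of x lie in O, and in p^k O for
    every k. *)
Lemma fractional_divisible0 n (M : set 'cV[A]_n) x :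
  fractional M -> divisible M x -> x = 0.
Proof.
move=> [g gu gM] xdiv; suff gx0 : g *m x = 0.
  by rewrite -[x](mulKmx gu) gx0 mulmx0.
have gO k : exists2 z, O_lattice z & g *m x = tofrac (p ^+ k) *: z.
  have [y My ->] := xdiv (p ^+ k) (expf_neq0 k p0).
  by exists (g *m y); [apply: gM; exists y|rewrite scalemxAr].
apply/matrixP => i j; rewrite (ord1 j) [RHS]mxE.
have [z zO xz] := gO 0%N; have [a za] := zO i.
have xa : (g *m x) i 0 = tofrac a.
  by rewrite xz mxE za expr0 tofrac1 mul1r.
rewrite xa; apply/eqP; rewrite tofrac_eq0; apply/eqP.
apply: (uniformizer_separated v_val v_ring p0 vp) => k.
have [y yO xy] := gO k; have [b yb] := yO i; exists b.
by apply/eqP; rewrite -tofrac_eq -xa xy mxE yb tofracM.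
Qed.

Hypothesis v_complete : val_complete v.

Section Projection.
Variables (n : nat) (M : set 'cV[A]_(1 + n)).
Hypotheses (M_sub : O_submodule M)
           (M_div : forall x, M x -> divisible M x -> x = 0).

Let M0 : M 0. Proof. by case: M_sub. Qed.
Let MD x y : M x -> M y -> M (x + y).
Proof. by case: M_sub => _ + _; apply. Qed.
Let MZ (a : O) x : M x -> M (tofrac a *: x).
Proof. by case: M_sub => _ _; apply. Qed.
Let MB x y : M x -> M y -> M (x - y).
Proof.
move=> Mx My; apply: MD => //.
by rewrite -scaleN1r -tofrac1 -tofracN; apply: MZ.
Qed.

Definition projection : set 'cV[A]_n :=
  [set x | exists t : A, M (col_mx t%:M x)].

Lemma projection_submodule : O_submodule projection.
Proof.
split=> [|x y [s Mx] [t My]|a x [t Mx]].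
- by exists 0; rewrite raddf0 col_mx0.
- by exists (s + t); rewrite raddfD -add_col_mx; apply: MD.
- exists (tofrac a * t); rewrite -scale_scalar_mx -scale_col_mx; exact: MZ.
Qed.

(** If M contained the whole kernel A x 0 of the projection, the vector (1, 0)
    would be divisible in M. *)
Lemma kernel_principal : exists g : A, forall t : A,
  M (col_mx t%:M 0) <-> exists a : O, t = tofrac a * g.
Proof.
have [||vert|//] := @submodule_full_or_principal O v v_val v_ring
    [set t | M (col_mx t%:M 0)].
- by rewrite /= raddf0 col_mx0.
- move=> a x /= Mx; rewrite -scale_scalar_mx -[0](scaler0 _ (tofrac a)).
  by rewrite -scale_col_mx; apply: MZ.
suff /eqP : col_mx 1%:M 0 = 0 :> 'cV[A]_(1 + n).
  by rewrite col_mx_eq0 -scalemx1 scaler_eq0 !oner_eq0.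
apply: M_div => [|a a0]; first exact: vert.
exists (col_mx (tofrac a)^-1%:M 0); first exact: vert.
by rewrite scale_col_mx scale_scalar_mx mulfV ?tofrac_eq0// scaler0.
Qed.

(** Points (c_k, x) of p^k M above x satisfy c_(k+1) - c_k \in p^k gO, since the
    two points differ by an element of p^k M with last coordinates 0. Hence
    c_k = c_0 + d_k g for a convergent sequence d_k in O, and the limit point
    above x belongs to p^k M for all k. *)
Lemma projection_divisible0 x : divisible projection x -> x = 0.
Proof.
move=> xdiv; have [g Ig] := kernel_principal.
have /choice[c cP] : forall k, exists c : A,
    exists2 y, M y & col_mx c%:M x = tofrac (p ^+ k) *: y.
  move=> k; have [y [t My] ->] := xdiv (p ^+ k) (expf_neq0 k p0).
  exists (tofrac (p ^+ k) * t); exists (col_mx t%:M y) => //.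
  by rewrite scale_col_mx scale_scalar_mx.
have cS k : exists a : O, c k.+1 - c k = tofrac (p ^+ k * a) * g.
  have [y My cy] := cP k; have [z Mz cz] := cP k.+1.
  have pk0 : tofrac (p ^+ k) != 0 by rewrite tofrac_eq0 expf_neq0.
  have : M (tofrac p *: z - y) by apply: MB => //; apply: MZ.
  have -> : tofrac p *: z - y =
      col_mx (((tofrac (p ^+ k))^-1 * (c k.+1 - c k))%:M) 0.
    apply: (scalerI pk0); rewrite scalerBr scalerA -tofracM -exprSr -cz -cy.
    rewrite opp_col_mx add_col_mx subrr scale_col_mx scaler0 scale_scalar_mx.
    by rewrite mulVKf// raddfB.
  by move=> /Ig[a ca]; exists a; rewrite tofracM -mulrA -ca mulVKf.
have /choice[a aP] := cS.
pose d k := \sum_(i < k) p ^+ i * a i.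
have cd k : c k = c 0%N + tofrac (d k) * g.
  elim: k => [|k IHk]; first by rewrite /d big_ord0 tofrac0 mul0r addr0.
  by rewrite /d big_ord_recr /= tofracD mulrDl -aP addrA -IHk addrC subrK.
have [|l lP] := adic_limit v_val v_ring p0 vp v_complete (c := d).
  by move=> k; exists (a k); rewrite /d big_ord_recr /= addrAC subrr add0r.
pose u := col_mx (c 0%N + tofrac l * g)%:M x.
have uM k : exists2 y, M y & u = tofrac (p ^+ k) *: y.
  have [y My cy] := cP k; have [b lb] := lP k.
  exists (y + col_mx (tofrac b * g)%:M 0).
    by apply: MD => //; apply/Ig; exists b.
  rewrite scalerDr -cy scale_col_mx scaler0 scale_scalar_mx add_col_mx addr0.
  rewrite -raddfD mulrA -tofracM -lb cd -addrA -mulrDl -tofracD.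
  by rewrite [d k + _]addrC subrK.
have Mu : M u by have [y My ->] := uM 0%N; apply: MZ.
have /eqP := M_div Mu (divisible_uniformizer M_sub uM).
by rewrite col_mx_eq0 => /andP[_ /eqP].
Qed.

(** The columns of T lift those of B to M. An element of M differs from an
    O-combination of them by an element of gO x 0, so M is spanned by
    the columns of T and by (g, 0), which is dropped from the basis when it is
    zero. *)
Lemma column_lattice_extend r (B : 'M[A]_(n, r)) :
    row_full B -> projection = column_lattice B ->
  exists s (C : 'M[A]_(1 + n, s)), row_full C /\ M = column_lattice C.
Proof.
move=> Bf pB.
have [g Ig] := kernel_principal.
have /choice[b bM] : forall j, exists t : A, M (col_mx t%:M (col j B)).
  move=> j; suff : projection (col j B) by [].
  rewrite pB; exists (delta_mx j 0); last by rewrite colE.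
  by move=> i; exists (i == j)%:R; rewrite mxE eqxx andbT rmorph_nat.
pose T : 'M[A]_(1 + n, r) := col_mx (\row_j b j) B.
have T_col j : M (col j T).
  suff -> : col j T = col_mx (b j)%:M (col j B) by [].
  rewrite col_col_mx; congr col_mx.
  by apply/matrixP => i k; rewrite !mxE !ord1 eqxx.
have M_T (x : 'cV[A]_(1 + n)) : M x -> exists2 c, @O_lattice O r c &
    exists a : O, x = T *m c + col_mx (tofrac a * g)%:M 0.
  move=> Mx; have : projection (dsubmx x).
    by exists (usubmx x 0 0); rewrite -mx11_scalar vsubmxK.
  rewrite pB => -[c cO cx]; exists c => //.
  have MTc : M (T *m c) by apply: (column_lattice_sub M_sub T_col); exists c.
  pose y : 'cV[A]_(1 + n) := x - T *m c.
  have yE : y = col_mx (usubmx y 0 0)%:M 0.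
    rewrite -mx11_scalar -[LHS]vsubmxK; congr col_mx.
    by rewrite raddfB /= mul_col_mx col_mxKd cx subrr.
  have : M y by apply: MB.
  rewrite yE => /Ig[a ua]; exists a.
  by rewrite -ua -yE addrC subrK.
have [g0|g0] := eqVneq g 0.
  exists r, T; split.
    exact: row_full_col_mx.
  apply/seteqP; split; last exact: column_lattice_sub.
  move=> x /M_T[c cO [a ->]]; exists c => //.
  by rewrite g0 mulr0 raddf0 col_mx0 addr0.
exists (1 + r)%N, (row_mx (col_mx g%:M 0) T); split.
  by rewrite -block_mxEh; apply: row_full_block_triangular.
apply/seteqP; split.
  move=> x /M_T[c cO [a ->]]; exists (col_mx (tofrac a)%:M c).
    move=> i; case: (split_ordP i) => j ->; last by rewrite col_mxEd.
    by exists a; rewrite col_mxEu mxE !ord1.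
  by rewrite mul_row_col mul_col_mx mul0mx -scalar_mxM mulrC addrC.
apply: column_lattice_sub => // i; case: (split_ordP i) => j ->.
  rewrite colKl (ord1 j) col_id; apply/Ig; exists 1.
  by rewrite tofrac1 mul1r.
by rewrite colKr.
Qed.

End Projection.

(** In dimension 0 there is only the zero module; the inductive step removes
    the first coordinate. *)
Lemma column_lattice_of_no_divisible n (M : set 'cV[A]_n) :
    O_submodule M -> (forall x, M x -> divisible M x -> x = 0) ->
  exists r (B : 'M[A]_(n, r)), row_full B /\ M = column_lattice B.
Proof.
elim: n M => [|n IHn] M M_sub M_div.
  exists 0%N, 0; split; first by rewrite /row_full mxrank0.
  apply/seteqP; split=> x _.
    by exists 0; [case|rewrite [LHS]flatmx0 [RHS]flatmx0].
  by rewrite flatmx0; case: M_sub.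
have [r [B [Bf pB]]] := IHn (projection M)
  (projection_submodule M_sub)
  (fun x _ => projection_divisible0 M_sub M_div (x := x)).
exact: (column_lattice_extend M_sub M_div Bf pB).
Qed.

End Structure.

Theorem proposition5p1 (O : idomainType) (O_dvr : complete_dvr O)
    (O_split : split_residue_field O) (n : nat) (n_ge1 : (1 <= n)%N) :
  (forall M : set 'cV[{fraction O}]_n, O_submodule M ->
     (fractional M <-> forall x, M x -> divisible M x -> x = 0))
  /\
  ((GL_orbits O n #= `I_n.+1)%card /\
   forall M N : set 'cV[{fraction O}]_n,
     fractional_submodules M -> fractional_submodules N ->
     (GL_orbit M = GL_orbit N <-> \dim (A_span M) = \dim (A_span N))).
Proof.
case: O_dvr => v [v_val v_ring v_compl].
have [p p0 vp] := uniformizer v_val v_ring.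
have frac_div := fractional_divisible0 v_val v_ring p0 vp.
have free := column_lattice_of_no_divisible v_val v_ring p0 vp v_compl.
have frac_free (M : set 'cV[{fraction O}]_n) : fractional_submodules M ->
    exists r (B : 'M[{fraction O}]_(n, r)), row_full B /\ M = column_lattice B.
  by move=> [M_sub M_frac]; apply: free => // x _; apply: frac_div.
split; [|split].
- move=> M M_sub; split=> [M_frac x _|M_div]; first exact: frac_div.
  have [r [B [Bf ->]]] := free _ M M_sub M_div.
  by case: (column_lattice_fractional Bf).
- rewrite card_eq_sym; apply/card_set_bijP.
  pose E r : 'M[{fraction O}]_(n, r) := pid_mx r.
  exists (fun r => GL_orbit (column_lattice (E r))); split.
  + move=> r rn; exists (column_lattice (E r)) => //.
    exact/column_lattice_fractional/pid_mx_row_full.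
  + move=> r s /set_mem rn /set_mem sn Ers.
    have Ef k : (k < n.+1)%N -> row_full (E k).
      by move=> kn; exact: (@pid_mx_row_full _ n k kn).
    exact/(GL_orbit_column_lattice (Ef r rn) (Ef s sn)).
  + move=> _ [M /frac_free[r [B [Bf ->]]] <-].
    have rn : (r <= n)%N by rewrite -(eqP Bf) rank_leq_row.
    exists r => //.
    by apply/(GL_orbit_column_lattice (pid_mx_row_full _ rn) Bf).
- move=> M N /frac_free[r [B [Bf ->]]] /frac_free[s [C [Cf ->]]].
  by rewrite !dim_A_span_column_lattice//; apply: GL_orbit_column_lattice.
Qed.
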